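(* Let $\mathcal{F}$ be a free filter on $\mathbb{N}$. The following conditions are equivalent: (1) $\mathcal{F}$ is a strong $P$-filter. (2) $K(\mathcal{F})$ is hereditarily Baire. (3) $K(C_p(N_{\mathcal{F}}))$ is hereditarily Baire.
   Context: Here $\mathbb{N}=\{0,1,2,\dots\}$. A filter on $\mathbb{N}$ is a family $\mathcal{F}$ of subsets of $\mathbb{N}$ with $\emptyset\notin\mathcal{F}$, $\mathbb{N}\in\mathcal{F}$, closed under supersets and under finite intersections; it is free if it contains all cofinite subsets of $\mathbb{N}$. Identifying sets with characteristic functions, $P(\mathbb{N})$ is identified with the Cantor set $2^{\mathbb{N}}$ (product topology) and $\mathcal{F}$ is given the subspace topology. $\mathcal{F}$ is a strong $P$-filter if for any sequence $(\mathcal{C}_n)_{n\in\mathbb{N}}$ of compact subsets of $\mathcal{F}$ there is a sequence $0=k_0<k_1<k_2<\dots$ of natural numbers such that $\bigcup_{n\in\mathbb{N}}(X_n\cap[k_n,k_{n+1}))\in\mathcal{F}$ whenever $X_n\in\mathcal{C}_n$ for each $n\in\mathbb{N}$. $N_{\mathcal{F}}$ is the space $\mathbb{N}\cup\{\infty\}$ in which points of $\mathbb{N}$ are isolated and $\{A\cup\{\infty\}:A\in\mathcal{F}\}$ is a neighborhood base at $\infty$. For a Tychonoff space $Y$, $C_p(Y)$ is the space of all continuous real-valued functions on $Y$ with the topology of pointwise convergence. $K(Y)$ denotes the space of all nonempty compact subsets of $Y$ with the Vietoris topology, whose basic open sets are $\langle U_0,\dots,U_n\rangle=\{K\in K(Y):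 K\subseteq\bigcup_{i\le n}U_i \text{ and } K\cap U_i\ne\emptyset \text{ for every } i\le n\}$, with each $U_i$ open in $Y$. A topological space is Baire if the intersection of every countable family of open dense subsets is dense; it is hereditarily Baire if every closed subspace is Baire. *)

(* Defs.v *)
From HB Require Import structures.
From mathcomp Require Import all_boot all_order all_algebra.
From mathcomp Require Import all_classical all_reals.
From mathcomp Require Import topology normedtype cantor.

Set Implicit Arguments.
Unset Strict Implicit.
Unset Printing Implicit Defensive.

Import numFieldNormedType.Exports.

Local Open Scope classical_set_scope.

Definition free_filter (F : set_system nat) : Prop :=
  forall A : set nat, finite_set (~` A) -> F A.

Definition support_set (x : cantor_space) : set nat := [set i | x i].

Definition filter_space (F : set_system nat) : topologicalType :=
  set_type [set x : cantor_space | F (support_set x)].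

Definition strong_P_filter (F : set_system nat) : Prop :=
  forall C : nat -> set (filter_space F), (forall n, compact (C n)) ->
  exists k : nat -> nat,
    [/\ k 0 = 0,
        forall n, k n < k n.+1 &
        forall X : nat -> filter_space F, (forall n, C n (X n)) ->
          F (\bigcup_n (support_set (set_val (X n)) `&`
                        [set i | k n <= i < k n.+1]))].

(* None is the point at infinity. *)
Definition NF (F : pfilter_on nat) : Type := option nat.

Section NF_topology.
Variable F : pfilter_on nat.

HB.instance Definition _ := Choice.copy (NF F) (option nat).

Definition NF_nbhs (x : NF F) : set_system (NF F) :=
  if x is Some n then principal_filter (Some n)
  else filter_from F (fun A => (Some @` A) `|` [set None]).

Let NF_nbhs_proper (x : NF F) : ProperFilter (NF_nbhs x).
Proof.
case: x => [n|] /=; first exact: principal_filter_proper.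
apply: filter_from_proper; last by move=> A _; exists None; right.
apply: filter_from_filter; first by exists setT; exact: filterT.
move=> A B FA FB; exists (A `&` B); first exact: filterI.
by move=> _ [[n [An Bn] <-]|->]; split; by [left; exists n|right].
Qed.

Let NF_nbhs_singleton (x : NF F) (U : set (NF F)) : NF_nbhs x U -> U x.
Proof.
case: x => [n /principal_filterP//|[A _]] /=; apply; by right.
Qed.

Let NF_nbhs_nbhs (x : NF F) (U : set (NF F)) :
  NF_nbhs x U -> NF_nbhs x (NF_nbhs^~ U).
Proof.
case: x => [n /principal_filterP Un|[A FA AU]] /=.
  by apply/principal_filterP => /=; apply/principal_filterP.
exists A => // _ [[n An <-]|->] /=; last by exists A.
by apply/principal_filterP; apply: AU; left; exists n.
Qed.

HB.instance Definition _ := hasNbhs.Build (NF F) NF_nbhs.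
HB.instance Definition _ := Nbhs_isNbhsTopological.Build (NF F)
  NF_nbhs_proper NF_nbhs_singleton NF_nbhs_nbhs.

End NF_topology.

(* A copy of the continuous functions Y -> R that does not carry the
   compact-open topology of continuousType. *)
Definition Cp (R : realType) (Y : topologicalType) : topologicalType :=
  set_type [set f : {ptws Y -> R} | continuous (f : Y -> R)].

Definition nonempty_compacts (Y : topologicalType) : set (set Y) :=
  [set K | compact K /\ K !=set0].

Definition vietoris (Y : topologicalType) : Type :=
  set_type (@nonempty_compacts Y).

Section vietoris_topology.
Variable Y : topologicalType.

HB.instance Definition _ :=
  Choice.copy (vietoris Y) (set_type (@nonempty_compacts Y)).

(* The pair (n, U) encodes <U_0, ..., U_n>; the values U_i with n < i are
   irrelevant. *)
Definition vietoris_index : set (nat * (nat -> set Y)) :=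
  [set nU | forall i, i <= nU.1 -> open (nU.2 i)].

Definition vietoris_base (nU : nat * (nat -> set Y)) : set (vietoris Y) :=
  [set K : vietoris Y |
    set_val K `<=` \bigcup_(i in [set i | i <= nU.1]) nU.2 i /\
    forall i, i <= nU.1 -> set_val K `&` nU.2 i !=set0].

Let vietoris_cover :
  \bigcup_(nU in vietoris_index) vietoris_base nU = [set: vietoris Y].
Proof.
apply/seteqP; split=> // K _; exists (0, fun=> setT).
  by move=> i _; exact: openT.
split=> [y _|i _]; first by exists 0.
by rewrite setIT; case: (set_valP K).
Qed.

Let vietoris_join (nU mV : nat * (nat -> set Y)) (K : vietoris Y) :
  vietoris_index nU -> vietoris_index mV ->
  vietoris_base nU K -> vietoris_base mV K ->
  exists lW, [/\ vietoris_index lW, vietoris_base lW K &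
                 vietoris_base lW `<=` vietoris_base nU `&` vietoris_base mV].
Proof.
case: nU mV => [n U] [m V] oU oV [KU UK] [KV VK].
pose UU := \bigcup_(i in [set i | i <= n]) U i.
pose VV := \bigcup_(i in [set i | i <= m]) V i.
pose W i := if i <= n then U i `&` VV else V (i - n.+1) `&` UU.
have WL i : i <= n -> W i = U i `&` VV by rewrite /W => ->.
have WR j : W (n.+1 + j) = V j `&` UU.
  by rewrite /W leqNgt leq_addr addKn.
have WP (P : set Y -> Prop) :
    (forall i, i <= n -> P (U i `&` VV)) ->
    (forall j, j <= m -> P (V j `&` UU)) ->
    forall i, i <= n.+1 + m -> P (W i).
  move=> PU PV i im; case: (leqP i n) => ni; first by rewrite WL//; exact: PU.
  by rewrite -(subnKC ni) WR; apply: PV; rewrite leq_subLR.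
have leqW_addr i : i <= n -> i <= n.+1 + m.
  by move=> im; rewrite addSn leqW// (leq_trans im)// leq_addr.
exists (n.+1 + m, W); split.
- apply: WP => [i im|j jm]; apply: openI.
  + exact: oU.
  + by apply: bigcup_open => h; exact: oV.
  + exact: oV.
  + by apply: bigcup_open => h; exact: oU.
- split=> /= [y Ky|i im].
    have [i /= im Uiy] := KU y Ky.
    by exists i; [exact: leqW_addr | rewrite WL//; split=> //; exact: KV].
  apply: (WP (fun S => set_val K `&` S !=set0) _ _ i im) => [h hn|j jm].
    by have [y [Ky Uy]] := UK _ hn; exists y; do 2 split=> //; exact: KV.
  by have [y [Ky Uy]] := VK _ jm; exists y; do 2 split=> //; exact: KU.
- move=> L [/= LW WL0]; have LUV : set_val L `<=` UU `&` VV.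
    move=> y /LW[i /= im]; apply: (WP (fun S => S y -> (UU `&` VV) y)) im.
      by move=> h hn [Uy Vy]; split=> //; exists h.
    by move=> j jm [Vy Uy]; split=> //; exists j.
  split.
    split=> [y /LUV[]//|h hn].
    have [|y [Ly]] := WL0 h; first exact: leqW_addr.
    by rewrite WL// => -[]; exists y.
  split=> [y /LUV[]//|j jm].
  have [|y [Ly]] := WL0 (n.+1 + j); first by rewrite leq_add2l.
  by rewrite WR => -[]; exists y.
Qed.

HB.instance Definition _ :=
  isBaseTopological.Build (vietoris Y) vietoris_cover vietoris_join.

End vietoris_topology.

Definition baire_space (T : topologicalType) : Prop :=
  forall U : nat -> set T, (forall n, open (U n) /\ dense (U n)) ->
    dense (\bigcap_n U n).

Definition hereditarily_baire (T : topologicalType) : Prop :=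
  forall A : set T, closed A -> baire_space (set_type A).

(* Main.v *)
Require Import Defs.
From mathcomp Require Import all_boot all_order all_algebra.
From mathcomp Require Import all_classical all_reals.
From mathcomp Require Import topology normedtype cantor.
From mathcomp Require Import sequences ring lra.

(* All spaces involved have their topology generated by a countable scale of
   "nearness" relations, and the Vietoris topology is generated by the
   corresponding Hausdorff relations.

   (1) => (3): build a tree of compact sets L_s in the given closed subset of
   K(C_p(N_F)), indexed by finite sequences s; the entry j appended to s bounds
   how far L_{s,j} may be from L_s, and L_{s,j} is chosen deep inside the
   |s|-th dense open set.  Along every branch the L_s converge to a compact set
   of functions on N_F.  The strong P-filter property, in its game form,
   provides a branch along which the sets where the members of L_s oscillate
   by less than 2^-|s| glue to members of F, so that the limit functions are
   continuous at infinity.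

   (3) => (2): A |-> 1_{N \ A} embeds F as a closed subspace of C_p(N_F), and K
   preserves closed embeddings.

   (2) => (1): for a finite set S let E_S be the set of all splices of sequences
   (X_n) in prod_n C_n along the partition of N cut out by S.  It is a compact
   subset of F, and so is Q_S := E_S U {N \ S}, from which S can be read off.
   In the closure of the family {Q_S} a generic element is of the form Q_S with
   S infinite; as this is a subset of F, S gives the sequence (k_n). *)

Set Implicit Arguments.
Unset Strict Implicit.
Unset Printing Implicit Defensive.

Import Order.TTheory GRing.Theory Num.Theory.
Import numFieldNormedType.Exports.

Local Open Scope classical_set_scope.

(** * Countable scales of nearness relations *)

(** A countable base of a uniformity: larger indices are finer, and composing two relations costs
    one index, as for the radii 2^-r. The sets [N r x] need not be open, whence the interiors taken
    later on. *)
Record nbhs_scale (T : topologicalType) (N : nat -> T -> T -> Prop) : Prop :=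
  NbhsScale {
    scale_refl : forall r x, N r x x;
    scale_sym : forall r x y, N r x y -> N r y x;
    scale_trans : forall r x y z, N r.+1 x y -> N r.+1 y z -> N r x z;
    scale_nbhsP : forall x U, nbhs x U <-> exists r, N r x `<=` U }.

Section scale.
Variables (T : topologicalType) (N : nat -> T -> T -> Prop).
Hypothesis sN : nbhs_scale N.

Lemma scale_nbhs r x : nbhs x (N r x).
Proof. by apply/(scale_nbhsP sN); exists r. Qed.

Lemma scale_le r s x y : r <= s -> N s x y -> N r x y.
Proof.
move=> /subnKC <-; elim: (s - r) x y => [|d IH] x y; first by rewrite addn0.
by rewrite addnS => Nxy; apply/IH/(scale_trans sN Nxy)/(scale_refl sN).
Qed.

Lemma scale_closureP A x : closure A x <-> forall r, exists2 y, A y & N r x y.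
Proof.
split=> [clA r|clA U /(scale_nbhsP sN)[r NU]].
  by have [y [Ay Ny]] := clA _ (scale_nbhs r x); exists y.
by have [y Ay Ny] := clA r; exists y; split=> //; exact: NU.
Qed.

Lemma scale_set_type (A : set T) :
  nbhs_scale (fun r (x y : set_type A) => N r (set_val x) (set_val y)).
Proof.
split=> [r x|r x y|r x y z|x U]; [exact: scale_refl sN _ _|
  exact: scale_sym sN _ _ _|exact: scale_trans sN _ _ _ _|split].
  case=> _ [[B oB <-] Bx BU].
  have /(scale_nbhsP sN)[r NB] : nbhs (set_val x) B by exact: open_nbhs_nbhs.
  by exists r => y Nxy; apply: BU; exact: NB.
case=> r NU; apply: filterS NU _.
exact: (@initial_continuous _ _ (@set_val _ A)) (scale_nbhs r (set_val x)).
Qed.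

End scale.

(** * The Hausdorff uniformity and the Vietoris topology *)

Definition hscale (T : Type) (N : nat -> T -> T -> Prop) (r : nat) (K L : set T) :=
  (forall x, K x -> exists2 y, L y & N r x y) /\
  (forall y, L y -> exists2 x, K x & N r x y).

Section vietoris_scale.
Variables (T : topologicalType) (N : nat -> T -> T -> Prop).
Hypothesis sN : nbhs_scale N.

Lemma vietoris_openP (U : set (vietoris T)) :
  open U <-> forall K, U K -> exists nV,
    [/\ vietoris_index nV, vietoris_base nV K & vietoris_base nV `<=` U].
Proof.
split=> [[D' D'D <-] K [nV D'nV KnV]|H].
  by exists nV; split=> //; [exact: D'D|move=> L; exists nV].
exists [set nV | vietoris_index nV /\ vietoris_base nV `<=` U].
  by move=> nV [].
apply/seteqP; split=> [K [nV [_ nVU] /nVU]//|K /H[nV [? ? ?]]].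
by exists nV.
Qed.

Lemma vietoris_nbhsP (K : vietoris T) U : nbhs K U <-> exists nV,
    [/\ vietoris_index nV, vietoris_base nV K & vietoris_base nV `<=` U].
Proof.
rewrite nbhsE; split=> [[B [/vietoris_openP oB BK] BU]|[nV [inV KnV nVU]]].
  have [nV [? ? nVB]] := oB _ BK; exists nV; split=> //.
  exact: subset_trans BU.
exists (vietoris_base nV) => //; split=> //; apply/vietoris_openP => L nVL.
by exists nV; split.
Qed.

(** A Lebesgue number: if the ball of level r around x lies in U, then so do the balls of level
    [r.+1] around all points [r.+1]-near to x, and near-covering makes the level uniform over K. *)
Lemma compact_scale_cover (K U : set T) : compact K -> open U -> K `<=` U ->
  exists r, forall x, K x -> N r x `<=` U.
Proof.
move=> /compact_near_coveringP cK oU KU.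
have /(_ nat \oo (fun r x => N r x `<=` U))[x Kx|r _ /(_ r (leqnn r))] := cK.
  have /(scale_nbhsP sN)[r NU] : nbhs x U by apply: open_nbhs_nbhs; split=> //; exact: KU.
  exists (N r.+1 x, [set i | r.+1 <= i]); first split=> /=.
  - exact: scale_nbhs.
  - by exists r.+1.
  - move=> [y i] /= [Nxy ri] z Nyz; apply/NU/(scale_trans sN Nxy).
    exact: scale_le Nyz.
by move=> NU; exists r => x /NU.
Qed.

(* By near-covering along the finite subsets of K, since compact_cover is only
   available for pointed spaces. *)
Lemma compact_scale_net r (K : set T) : compact K ->
  exists2 s : seq T, {in s, forall x, K x} &
    forall x, K x -> exists2 y, y \in s & (N r y)° x.
Proof.
pose B (t : set T) := [set s : set T | [/\ finite_set s, s `<=` K & t `<=` s]].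
move=> /compact_near_coveringP cK.
pose F := filter_from [set t | finite_set t /\ t `<=` K] B.
have FF : Filter F.
  apply: filter_from_filter; first by exists set0; split=> // x [].
  move=> t t' [ft Kt] [ft' Kt']; exists (t `|` t').
    by split; [rewrite finite_setU|move=> x [/Kt|/Kt']].
  by move=> s [fs Ks tt's]; split; split=> // x xt; apply: tt's; [left|right].
have /(_ _ F (fun s x => exists2 y, s y & (N r y)° x))[x Kx|t [ft Kt] /(_ t)] := cK.
  exists ((N r x)°, B [set x]); first split=> /=.
  - by apply: nbhs_interior; exact: scale_nbhs.
  - by exists [set x] => //; split=> // y ->.
  - by move=> [y s] /= [Nxy [_ _ xs]]; exists x => //; exact: xs.
have [s ts] := (finite_seqP t).1 ft; rewrite ts in ft Kt *.
move=> /(_ (And3 ft Kt (@subset_refl _ _))) Kt'; exists s => x; first exact: Kt.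
by move=> /Kt'.
Qed.

(** Compactness gives both comparisons. Inside a basic open set, a Lebesgue number settles the
    covering condition and finitely many chosen points settle the hitting conditions; conversely,
    the interiors of balls around a finite net of K define a basic open set. *)
Lemma vietoris_scale :
  nbhs_scale (fun r (K L : vietoris T) => hscale N r (set_val K) (set_val L)).
Proof.
split=> [r K|r K L [KL LK]|r K L M [KL LK] [LM ML]|K U].
- by split=> x Kx; exists x => //; exact: scale_refl sN _ _.
- by split=> [x /LK|x /KL] [y ? ?]; exists y => //; exact: scale_sym sN _ _ _ _.
- split=> [x /KL[y /LM[z ? Nyz] Nxy]|z /ML[y /LK[x ? Nxy] Nyz]].
    by exists z => //; exact: scale_trans sN _ _ _ _ Nxy Nyz.
  by exists x => //; exact: scale_trans sN _ _ _ _ Nxy Nyz.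
split=> [/vietoris_nbhsP[[n V] [/= oV [/= KV VK] VU]]|[r NU]].
  have [cK _] := set_valP K.
  have [|r NV] := compact_scale_cover cK _ KV.
    by apply: bigcup_open => i; exact: oV.
  have [s NsV] : exists s, forall i, i <= n ->
      exists2 x, set_val K x & N s x `<=` V i.
    have {}VK i : i <= n -> exists s, exists2 x, set_val K x & N s x `<=` V i.
      move=> ni; have [x [Kx Vx]] := VK _ ni.
      have /(scale_nbhsP sN)[s NV'] : nbhs x (V i).
        by apply: open_nbhs_nbhs; split=> //; exact: oV.
      by exists s, x.
    elim: n {oV KV VU NV} VK => [|n IH] VK.
      by have [s [x Kx NV]] := VK 0 (leqnn _); exists s => -[|//] _; exists x.
    have [|s NV] := IH; first by move=> i ni; apply: VK; exact: leqW.
    have [s' [x Kx NV']] := VK n.+1 (leqnn _); exists (maxn s s') => i.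
    rewrite leq_eqVlt => /predU1P[->|/NV[y Ky NVy]].
      by exists x => // z Nz; apply/NV'/(scale_le sN _ Nz)/leq_maxr.
    by exists y => // z Nz; apply/NVy/(scale_le sN _ Nz)/leq_maxl.
  exists (maxn r s) => L [KL LK]; apply: VU; split=> /= [y /LK[x Kx Nxy]|i ni].
    by apply: (NV x) => //; apply: (scale_le sN _ Nxy); exact: leq_maxl.
  have [x Kx NV'] := NsV _ ni; have [y Ly Nxy] := KL _ Kx; exists y; split=> //.
  by apply/NV'/(scale_le sN _ Nxy)/leq_maxr.
apply/vietoris_nbhsP; have [cK [x0 Kx0]] := set_valP K.
have [s0 s0K netK] := compact_scale_net r.+1 cK.
(* Prepending x0 keeps the list nonempty, and the default value of [nth] is then a member of K as
   well. *)
pose s := x0 :: s0.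
have NI x : (N r.+1 x)° x.
  by apply: nbhs_singleton; apply: nbhs_interior; exact: scale_nbhs.
have sK i : set_val K (nth x0 s i).
  have [/(mem_nth x0)|ige] := ltnP i (size s); last by rewrite nth_default.
  by rewrite inE => /predU1P[->//|/s0K].
have {}netK x : set_val K x ->
    exists2 i, i <= (size s).-1 & (N r.+1 (nth x0 s i))° x.
  move=> /netK[y ys Nyx]; exists (index y s).
    by rewrite -ltnS prednK// index_mem inE ys orbT.
  by rewrite nth_index// inE ys orbT.
exists ((size s).-1, fun i => (N r.+1 (nth x0 s i))°); split.
- by move=> i _; exact: open_interior.
- split=> /= [x /netK[i]|i _]; first by exists i.
  by exists (nth x0 s i); split.
- move=> L [/= LN NL]; apply: NU; split=> [x /netK[i ilt Nix]|y /LN[i _ Ny]].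
    have [y [Ly /interior_subset Ndy]] := NL _ ilt.
    exists y => //; move/interior_subset: Nix => Nix.
    exact: scale_trans sN _ _ _ _ (scale_sym sN Nix) Ndy.
  exists (nth x0 s i) => //; apply: (scale_le sN (leqnSn r)).
  exact: interior_subset Ny.
Qed.

End vietoris_scale.

(** * The Baire property of subspaces and closed embeddings *)

(** Baireness of the subspace A in terms of open sets of the ambient space, so that later
    constructions avoid the subtype. *)
Definition relatively_baire (T : topologicalType) (A : set T) :=
  forall O : nat -> set T, (forall n, open (O n)) ->
    (forall n W, open W -> W `&` A !=set0 -> W `&` A `&` O n !=set0) ->
  forall W, open W -> W `&` A !=set0 -> exists x, [/\ W x, A x & forall n, O n x].

Lemma baire_space_set_type (T : topologicalType) (A : set T) :
  baire_space (set_type A) <-> relatively_baire A.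
Proof.
have oval (B : set T) : open B -> open (@set_val _ A @^-1` B) by exists B.
split=> [bA O oO dO W oW [x [Wx Ax]]|bA U oU].
  have dense_O n : open (@set_val _ A @^-1` O n) /\ dense (@set_val _ A @^-1` O n).
    split; first exact: oval.
    move=> V0 [a Va] [V oV Vval]; rewrite -Vval in Va *.
    have [|y [[Vy Ay] Oy]] := dO n V oV.
      by exists (set_val a); split=> //; exact: set_valP.
    by exists (SigSub (mem_set Ay)); split.
  have [||y [Wy Oy]] := bA _ dense_O (set_val @^-1` W).
  - by exists (SigSub (mem_set Ax)).
  - exact: oval.
  - by exists (set_val y); split=> // [|n]; [exact: set_valP|exact: Oy].
move=> W0 [a Wa] [W oW Wval]; rewrite -Wval in Wa *.
have /choice[O OU] : forall n, exists O, open O /\ set_val @^-1` O = U n.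
  by move=> n; have [[O oO <-] _] := oU n; exists O.
have [n|n V oV [x [Vx Ax]]||y [Wy Ay Oy]] := bA O _ _ W oW.
- by have [] := OU n.
- have [_ /(_ (set_val @^-1` V))[||y]] := oU n.
  + by exists (SigSub (mem_set Ax)).
  + exact: oval.
  + have [_ <-] := OU n; move=> [Vy Oy].
    by exists (set_val y); split=> //; split=> //; exact: set_valP.
- by exists (set_val a); split=> //; exact: set_valP.
exists (SigSub (mem_set Ay)); split=> // n _.
by have [_ <-] := OU n; exact: Oy.
Qed.

Section scale_embedding.
Variables (S T : topologicalType) (M : nat -> S -> S -> Prop)
  (N : nat -> T -> T -> Prop) (e : S -> T).
Hypotheses (sM : nbhs_scale M) (sN : nbhs_scale N).
Hypothesis eN : forall r, exists s, forall x y, N s (e x) (e y) -> M r x y.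

(** A cluster point of the image filter lies in the image of K, and uniform continuity of the
    inverse map, which is [eN], makes its preimage in K a cluster point. *)
Lemma compact_scale_embedding (K : set S) : compact (e @` K) -> compact K.
Proof.
move=> cK G PG GK.
have eGK : (e @ G) (e @` K) by apply: (@filterS _ G) GK => x Kx; exists x.
have [_ [[x Kx <-] clx]] := cK _ _ eGK.
exists x; split=> // A B GA /(scale_nbhsP sM)[r MB].
have [s NM] := eN r.
have [|_ [[y Ay <-] Nxy]] := clx (e @` A) _ _ (scale_nbhs sN s (e x)).
  by apply: (@filterS _ G) GA => y Ay; exists y.
by exists y; split=> //; apply: MB; exact: NM.
Qed.

Hypothesis eM : forall r, exists s, forall x y, M s x y -> N r (e x) (e y).

Lemma scale_embedding_continuous : continuous e.
Proof.
move=> x U /(scale_nbhsP sN)[r NU]; have [s MN] := eM r.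
by apply/(scale_nbhsP sM); exists s => y /MN/NU.
Qed.

Hypothesis e_closed : closed (range e).

Lemma hereditarily_baire_embedding : hereditarily_baire T -> hereditarily_baire S.
Proof.
move=> hT A clA; apply/baire_space_set_type => O oO dO W oW [a [Wa Aa]].
(* For open B, [up B] is an open set of T with preimage B under e: it unites interiors of balls
   whose traces on the range come from B. *)
pose up (B : set S) := \bigcup_(x in B) \bigcup_(r in [set r |
   forall y, N r (e x) (e y) -> B y]) (N r (e x))°.
have oup B : open (up B) by do 2 apply: bigcup_open => ? _; exact: open_interior.
have upE (B : set S) x : open B -> up B (e x) <-> B x.
  move=> oB; split=> [[y By [r /= NB]] /interior_subset /NB //|Bx].
  have /(scale_nbhsP sM)[r MB] : nbhs x B by apply: open_nbhs_nbhs.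
  have [s NM] := eN r; exists x => //; exists s => /=; first by move=> y /NM/MB.
  by apply: nbhs_singleton; apply: nbhs_interior; exact: scale_nbhs.
have clA' : closed (e @` A).
  move=> y cly; have [x _ xy] : range e y.
    by apply: e_closed; apply: closureS cly => _ [x Ax <-]; exists x.
  rewrite -{}xy in cly *; exists x => //; apply: clA => U /(scale_nbhsP sM)[r MU].
  have [s NM] := eN r.
  have [_ [[z Az <-] Nz]] := cly _ (scale_nbhs sN s (e x)).
  by exists z; split=> //; apply/MU/NM.
have /baire_space_set_type bA' := hT _ clA'.
have [n|n V oV [z [Vz [x Ax xz]]]|||z [Wz [x Ax xz] Oz]] :=
  bA' (fun n => up (O n)) _ _ (up W).
- exact: oup.
- have [||y [[Vy Ay] Oy]] := dO n (e @^-1` V).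
  + by apply: open_comp => // y _; exact: scale_embedding_continuous.
  + by exists x; split=> //=; rewrite xz.
  + by exists (e y); split; [split=> //; exists y|apply/upE].
- exact: oup.
- by exists (e a); split; [exact/upE|exists a].
rewrite -{}xz in Wz Oz.
exists x; split=> //; first exact/upE.
by move=> n; apply/upE; [exact: oO|exact: Oz].
Qed.

End scale_embedding.

Section vietoris_embedding.
Variables (S T : topologicalType) (M : nat -> S -> S -> Prop)
  (N : nat -> T -> T -> Prop) (e : S -> T).
Hypotheses (sM : nbhs_scale M) (sN : nbhs_scale N).
Hypothesis eN : forall r, exists s, forall x y, N s (e x) (e y) -> M r x y.
Hypothesis eM : forall r, exists s, forall x y, M s x y -> N r (e x) (e y).
Hypothesis e_closed : closed (range e).

Lemma vietoris_image_subproof (K : vietoris S) :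
  e @` set_val K \in @nonempty_compacts T.
Proof.
have [cK [x Kx]] := set_valP K; apply/mem_set; split; last by exists (e x), x.
apply: continuous_compact => //; apply: continuous_subspaceT.
exact: scale_embedding_continuous sM sN eM.
Qed.

Definition vietoris_image (K : vietoris S) : vietoris T :=
  SigSub (vietoris_image_subproof K).

(** Taking images under e is again a closed embedding: a limit of images stays inside the closed
    range of e, and its preimage is compact by [compact_scale_embedding]. *)
Lemma hereditarily_baire_vietoris_embedding :
  hereditarily_baire (vietoris T) -> hereditarily_baire (vietoris S).
Proof.
apply: (hereditarily_baire_embedding (vietoris_scale sM) (vietoris_scale sN)
  (e := vietoris_image)) => [r|r|].
- have [s NM] := eN r; exists s => K L [KL LK].
  split=> [x Kx|y Ly].
    have [|_ [y Ly <-] /NM] := KL (e x); first by exists x.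
    by exists y.
  have [|_ [x Kx <-] /NM] := LK (e y); first by exists y.
  by exists x.
- have [s MN] := eM r; exists s => K L [KL LK].
  split=> [_ [x /KL[y Ly Mxy] <-]|_ [y /LK[x Kx Mxy] <-]].
    by exists (e y); [exists y|exact: MN].
  by exists (e x); [exists x|exact: MN].
- move=> L /(scale_closureP (vietoris_scale sN)) clL.
  have Le : set_val L `<=` range e.
    move=> y Ly; apply: e_closed; apply/(scale_closureP sN) => r.
    have [_ [K _ <-] [/(_ _ Ly)[_ [x _ <-] ?] _]] := clL r.
    by exists (e x) => //; exists x.
  have [cL [y Ly]] := set_valP L.
  have eL : e @` (e @^-1` set_val L) = set_val L.
    by apply/seteqP; split=> [_ [x ? <-]//|z Lz]; have [x _ xz] := Le _ Lz;
      exists x => //=; rewrite xz.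
  have KP : e @^-1` set_val L \in @nonempty_compacts S.
    apply/mem_set; split; last by have [x _ xy] := Le _ Ly; exists x => /=; rewrite xy.
    by apply: (compact_scale_embedding sM sN eN); rewrite eL.
  by exists (SigSub KP) => //; apply: val_inj.
Qed.

End vietoris_embedding.

(** * Concrete scales: products, Cantor space, functions on N_F *)

(** Level r constrains only the coordinates of rank below r. By injectivity of the rank there are
    finitely many of them, so the balls are neighbourhoods in the product topology. *)
Lemma prod_scale (I : eqType) (T : I -> topologicalType) (rank : I -> nat)
    (N : forall i, nat -> T i -> T i -> Prop) :
  injective rank -> (forall i, nbhs_scale (@N i)) ->
  nbhs_scale (fun r (f g : prod_topology T) =>
    forall i, rank i < r -> N i r (f i) (g i)).
Proof.
move=> rank_inj sN.
have refl r (f : prod_topology T) i : N i r (f i) (f i) by exact: scale_refl (sN i) _ _.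
split=> [//|r f g fg i ir|r f g h fg gh i ir|f U].
- exact: scale_sym (sN i) _ _ _ (fg _ ir).
- exact: scale_trans (sN i) _ _ _ _ (fg _ (leqW ir)) (gh _ (leqW ir)).
split=> [fU|[r NU]]; last first.
  have FN : Filter (nbhs f) := nbhs_filter f.
  apply: filterS NU _.
  have : forall m, nbhs f [set g | forall i, rank i < m -> N i r (f i) (g i)].
    elim=> [|m IH]; first by apply: filterS filterT => g _ i.
    have [[i im]|nex] := pselect (exists i, rank i = m); last first.
      apply: filterS IH => g fg j; rewrite ltnS leq_eqVlt => /predU1P[jm|/fg//].
      by case: nex; exists j.
    have fi : nbhs f [set g | N i r (f i) (g i)].
      exact: (@proj_continuous _ T i f) (scale_nbhs (sN i) r (f i)).
    apply: filterS2 IH fi => g fg fgi j.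
    rewrite ltnS leq_eqVlt => /predU1P[|/fg//].
    by rewrite -im => /rank_inj ->.
  by apply.
pose B r := [set g : prod_topology T | forall i, rank i < r -> N i r (f i) (g i)].
(* Conversely the filter of balls converges to f, since each coordinate is controlled to any
   precision from some level on. *)
have FF : Filter (filter_from setT B).
  apply: filter_from_filter; first by exists 0.
  move=> r s _ _; exists (maxn r s) => // g Bg; split=> i ir.
    have /Bg : rank i < maxn r s by rewrite (leq_trans ir)// leq_maxl.
    by apply: scale_le (sN i) _ _ _ _ _; exact: leq_maxl.
  have /Bg : rank i < maxn r s by rewrite (leq_trans ir)// leq_maxr.
  by apply: scale_le (sN i) _ _ _ _ _; exact: leq_maxr.
suff /(_ _ fU)[r _ BU] : filter_from setT B --> f by exists r.
apply/cvg_sup => i V [_ [[W oW <-] Wf WV]].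
have /(scale_nbhsP (sN i))[s NW] : nbhs (f i) W by exact: open_nbhs_nbhs.
exists (maxn s (rank i).+1) => // g Bg; apply: WV; apply: NW.
have /Bg : rank i < maxn s (rank i).+1 by rewrite leq_max ltnSn orbT.
by apply: scale_le (sN i) _ _ _ _ _; exact: leq_maxl.
Qed.

Definition cantor_near (r : nat) (x y : cantor_space) := forall i, i < r -> x i = y i.

Lemma cantor_scale : nbhs_scale cantor_near.
Proof.
apply: (@prod_scale nat (fun=> bool) id (fun _ _ (x y : bool) => x = y)) => // _.
split=> [//|//|_ x y z -> //|x U]; split=> [/nbhs_singleton Ux|[_ xU]].
  by exists 0 => _ <-.
by apply: filterS xU _; rewrite nbhs_principalE; apply/principal_filterP.
Qed.

Section NF_scale.
Variables (R : realType) (F : pfilter_on nat).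

(** The point at infinity gets rank 0, so every level from 1 on controls the value there; [Some i]
    is controlled from level [i.+2] on. *)
Definition NF_rank (o : NF F) : nat := if o is Some i then i.+1 else 0.

Definition NF_near (r : nat) (f g : {ptws NF F -> R}) :=
  forall o, NF_rank o < r -> (`|f o - g o| < 2^-1 ^+ r)%R.

Local Open Scope ring_scope.

Lemma expr_half_gt0 r : (0 < 2^-1 ^+ r :> R)%R.
Proof. by rewrite exprn_gt0// invr_gt0. Qed.

Lemma expr_half_le1 r : (2^-1 ^+ r <= 1 :> R)%R.
Proof. by rewrite exprn_ile1// ?invr_ge0// invf_le1 ?ler1n. Qed.

Lemma expr_half_lt (e : R) : (0 < e)%R -> exists r, (2^-1 ^+ r < e)%R.
Proof.
move=> e0; have : `|2^-1 : R| < 1 by rewrite gtr0_norm//; lra.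
move=> /cvg_expr /cvgr0_norm_lt /(_ e e0)[r _ /(_ r (leqnn r)) /= re].
by exists r; exact: le_lt_trans (ler_norm _) re.
Qed.

Lemma real_scale : nbhs_scale (fun r (x y : R) => `|x - y| < 2^-1 ^+ r)%R.
Proof.
split=> [r x|r x y|r x y z|x U].
- by rewrite subrr normr0 expr_half_gt0.
- by rewrite distrC.
- rewrite exprS => xy yz; have := ler_distD y x z; lra.
split=> [/nbhs_ballP[e e0 xU]|[r xU]]; last first.
  by apply/nbhs_ballP; exists (2^-1 ^+ r) => //=; exact: expr_half_gt0.
have [r re] := expr_half_lt e0.
by exists r => y xy; apply: xU; rewrite /ball/= (lt_trans xy).
Qed.

Lemma NF_scale : nbhs_scale NF_near.
Proof.
apply: (@prod_scale (NF F) (fun=> R) NF_rank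
  (fun _ r x y => `|x - y| < 2^-1 ^+ r)%R) => [|_]; last exact: real_scale.
by move=> [i|] [j|] // [->].
Qed.

End NF_scale.

Lemma NF_continuousP (R : realType) (F : pfilter_on nat) (f : NF F -> R) :
  continuous f <->
  forall r, F [set i | `|f (Some i) - f None| < 2^-1 ^+ r]%R.
Proof.
split=> [cf r|Ff].
  have /cf[A FA AU] : nbhs (f None) [set y | `|f None - y| < 2^-1 ^+ r]%R.
    by apply/(scale_nbhsP (real_scale R)); exists r.
  by apply: filterS FA => i Ai /=; rewrite distrC; apply: AU; left; exists i.
move=> [i|] U /=.
  by move=> /nbhs_singleton Ui; apply/principal_filterP.
move=> /(scale_nbhsP (real_scale R))[r rU].
exists [set i | `|f (Some i) - f None| < 2^-1 ^+ r]%R; first exact: Ff.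
move=> _ [[i fi <-]|->]; apply: rU; first by rewrite distrC.
by rewrite subrr normr0 expr_half_gt0.
Qed.

Lemma eq_expr_half (R : realType) (x y : R) :
  (forall r, `|x - y| < 2^-1 ^+ r)%R -> x = y.
Proof.
move=> xy; apply/eqP; rewrite -subr_eq0 -normr_le0 leNgt; apply/negP.
by move=> /expr_half_lt[r]; rewrite ltNge (ltW (xy r)).
Qed.

Lemma Cp_scale (R : realType) (F : pfilter_on nat) :
  nbhs_scale (fun r (f g : Cp R (NF F)) => NF_near r (set_val f) (set_val g)).
Proof. exact: (scale_set_type (NF_scale R F)
  [set f | continuous (f : NF F -> R)]). Qed.

Lemma filter_space_scale (F : set_system nat) :
  nbhs_scale (fun r (x y : filter_space F) => cantor_near r (set_val x) (set_val y)).
Proof. exact: (scale_set_type cantor_scale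
  [set x | F (support_set x)]). Qed.

(** * The closed embedding of F into C_p(N_F) *)

Section embed.
Variables (R : realType) (F : pfilter_on nat).

Definition cofun (x : nat -> bool) (o : NF F) : R :=
  if o is Some i then (~~ x i)%:R else 0%R.

Lemma cofun_subproof (x : filter_space F) : cofun (set_val x) \in
  [set f : {ptws NF F -> R} | continuous (f : NF F -> R)].
Proof.
apply/mem_set/NF_continuousP => r.
have Fx : F (support_set (set_val x)) := set_valP x.
apply: filterS Fx => i xi /=; by rewrite [set_val x i]xi /= subrr normr0 expr_half_gt0.
Qed.

Definition Cp_embed (x : filter_space F) : Cp R (NF F) := SigSub (cofun_subproof x).

(** A pointwise limit of 0-1 valued functions vanishing at infinity is of the same kind; its
    continuity at infinity, used at precision 1/2, puts its zero set in F. *)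
Lemma Cp_embed_closed : closed (range Cp_embed).
Proof.
move=> f /(scale_closureP (Cp_scale R F)) clf.
pose g : NF F -> R := set_val f.
have {}clf r : exists x : nat -> bool, NF_near r g (cofun x).
  by have [_ [x _ <-] fx] := clf r; exists (set_val x).
pose x i : bool := (`|g (Some i)| < 2^-1)%R.
have gx : g = cofun x.
  apply/funext => o; apply: eq_expr_half => r.
  have [y /(_ o)] := clf (maxn r (NF_rank o).+1).
  rewrite leq_max ltnSn orbT => /(_ isT) gy.
  suff -> : cofun x o = cofun y o.
    by apply: (scale_le (real_scale R) _ gy); exact: leq_maxl.
  have : (`|g o - cofun y o| < 2^-1 ^+ 1)%R.
    by apply: (scale_le (real_scale R) _ gy); rewrite leq_max orbT.
  case: o {gy} => //= i; rewrite expr1 /x; case: (y i) => /=.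
    by rewrite subr0 => ->.
  by move=> + ; rewrite !ltr_norml => /andP[g1 _]; case: andP => //= -[_ g2]; lra.
have Fx : F (support_set x).
  have cg : continuous g := set_valP f.
  have /NF_continuousP/(_ 1) := cg.
  apply: filterS => i /=; rewrite expr1 gx /= subr0 /support_set /=.
  by case: (x i) => //=; rewrite normr1; lra.
exists (SigSub (mem_set (Fx : [set x | F (support_set x)] x))) => //; exact: val_inj.
Qed.
End embed.

Lemma hereditarily_baire_vietoris_filter_space (R : realType) (F : pfilter_on nat) :
  hereditarily_baire (vietoris (Cp R (NF F))) ->
  hereditarily_baire (vietoris (filter_space F)).
Proof.
apply: (hereditarily_baire_vietoris_embedding (filter_space_scale F)
  (Cp_scale R F) (e := @Cp_embed R F)) => [r|r|].
(* The index moves by one because [Some i] has rank [i.+1]; values in {0, 1} at distance less than 1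
   coincide. *)
- exists r.+1 => x y xy i ir.
  have {xy}: (`|(~~ set_val x i)%:R - (~~ set_val y i)%:R| < 2^-1 ^+ r.+1 :> R)%R.
    exact: xy (Some i) ir.
  have := expr_half_le1 R r.+1.
  case: (set_val x i) (set_val y i) => [] [] //= r1;
    by rewrite ?sub0r ?subr0 ?normrN normr1 ltNge r1.
- exists r => x y xy [i|] /=; last by rewrite subrr normr0 expr_half_gt0.
  move=> /ltnW/xy xyi.
  suff -> : set_val (Cp_embed R x) (Some i) = set_val (Cp_embed R y) (Some i).
    by rewrite subrr normr0 expr_half_gt0.
  exact: (congr1 (fun b : bool => (~~ b)%:R%R : R) xyi).
- exact: Cp_embed_closed.
Qed.

(** * Splices along a set, and the implication from (2) to (1) *)

(* Counts the elements of S in [1, i]: the value of S at 0 is ignored. *)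
Definition count_upto (S : nat -> bool) (i : nat) := count S (iota 1 i).

Lemma count_uptoS S i : count_upto S i.+1 = count_upto S i + S i.+1.
Proof. by rewrite /count_upto -[in LHS](addn1 i) iotaD count_cat /= addn0 add1n. Qed.

Lemma count_upto_le S i j : i <= j -> count_upto S i <= count_upto S j.
Proof.
move=> /subnKC <-; elim: (j - i) => [|d IH]; first by rewrite addn0.
by rewrite addnS count_uptoS (leq_trans IH)// leq_addr.
Qed.

Lemma eq_count_upto S S' m i : (forall j, j < m -> S j = S' j) -> i < m ->
  count_upto S i = count_upto S' i.
Proof.
move=> SS' im; apply: eq_in_count => j; rewrite mem_iota add1n ltnS => /andP[_ ji].
exact/SS'/(leq_ltn_trans ji).
Qed.

(** [k n] is the least i at which the count reaches n, so the count equals n exactly on [k n, k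
    n.+1). Strict growth holds because the count rises by at most one per step. *)
Lemma count_upto_inv (S : nat -> bool) : (forall n, exists2 i, n <= i & S i) ->
  exists k : nat -> nat, [/\ k 0 = 0, forall n, k n < k n.+1 &
    forall i, k (count_upto S i) <= i < k (count_upto S i).+1].
Proof.
move=> Sinf; have cinf n : exists i, n <= count_upto S i.
  elim: n => [|n [i ni]]; first by exists 0.
  have [j ij Sj] := Sinf i.+1; exists j; case: j Sj ij => // j Sj ij.
  by rewrite count_uptoS Sj addn1 ltnS (leq_trans ni)// count_upto_le.
pose k n := ex_minn (cinf n).
have kP n i : (k n <= i) = (n <= count_upto S i).
  rewrite /k; case: ex_minnP => m nm mmin; apply/idP/idP => [mi|/mmin//].
  by rewrite (leq_trans nm)// count_upto_le.
exists k; split=> [|n|i]; first by apply/eqP; rewrite -leqn0 kP.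
  rewrite ltnNge kP -ltnNge; case kn : (k n) => [|m]; first by [].
  have : ~~ (k n <= m) by rewrite kn ltnn.
  rewrite kP -ltnNge => mn; rewrite count_uptoS ltnS.
  by case: (S m.+1); rewrite ?addn1// addn0 ltnW.
by rewrite kP leqnn ltnNge kP ltnn.
Qed.

Lemma compact_scale_cluster (T : topologicalType) (N : nat -> T -> T -> Prop)
    (K : set T) (u : nat -> T) : nbhs_scale N -> compact K ->
  (forall n, K (u n)) ->
  exists2 x, K x & forall r n, exists2 m, n <= m & N r x (u m).
Proof.
move=> sN cK Ku; have [|x [Kx clx]] := cK (u @ \oo) _.
  by exists 0 => // n _; exact: Ku.
exists x => // r n; have [||_ [[m nm <-] Nx]] := clx (u @` [set m | n <= m]) (N r x).
- by exists n => // m nm; exists m.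
- exact: scale_nbhs.
by exists m.
Qed.

Lemma scale_open (T : topologicalType) (N : nat -> T -> T -> Prop) (U : set T) :
  nbhs_scale N -> (forall x, U x -> exists r, N r x `<=` U) -> open U.
Proof. by move=> sN NU; rewrite openE => x /NU /(scale_nbhsP sN). Qed.

Definition agree_on (D : set cantor_space) (I : set nat) : set cantor_space :=
  [set x | exists2 y, D y & forall i, I i -> x i = y i].

(** Members of D agreeing with x on longer and longer pieces of I cluster at a member of D that
    agrees with x on all of I. *)
Lemma closed_agree_on (D : set cantor_space) (I : set nat) : compact D ->
  closed (agree_on D I).
Proof.
move=> cD x /(scale_closureP cantor_scale) clx.
have /choice[u uP] : forall r, exists y, D y /\ forall i, i < r -> I i -> x i = y i.
  move=> r; have [z [y Dy zy] xz] := clx r; exists y; split=> // i ir Ii.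
  by rewrite xz// zy.
have [y Dy yu] := compact_scale_cluster cantor_scale cD (fun r => (uP r).1).
exists y => // i Ii; have [m im yum] := yu i.+1 i.+1.
by rewrite yum// (uP m).2.
Qed.

Lemma free_filter_tail (F : pfilter_on nat) (A B : set nat) (m : nat) :
  free_filter F -> F A -> (forall i, m <= i -> A i -> B i) -> F B.
Proof.
move=> freeF FA AB; have Fm : F [set i | m <= i].
  apply: freeF; apply: sub_finite_set (finite_II m) => i /=.
  by move/negP; rewrite -ltnNge.
by apply: filterS (filterI Fm FA) => i [/AB].
Qed.

Lemma compact_filter_space (F : set_system nat) (D : set cantor_space) : compact D ->
  D `<=` [set x | F (support_set x)] ->
  compact [set x : filter_space F | D (set_val x)].
Proof.
move=> cD DF; apply: (compact_scale_embedding (filter_space_scale F) cantor_scale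
  (e := set_val)); first by move=> r; exists r.
suff -> : set_val @` [set x : filter_space F | D (set_val x)] = D by [].
apply/seteqP; split=> [_ [x Kx <-]//|x Dx].
by exists (SigSub (mem_set (DF _ Dx))).
Qed.

Section splice.
Variable D : nat -> set cantor_space.

(* The members of splice S do not contain 0, so that 0 marks the complement of S
   in coded_splice S (when S does not contain 0). *)
Definition splice (S : nat -> bool) : set cantor_space :=
  [set x | x 0 = false] `&`
  \bigcap_n agree_on (D n) [set i | 0 < i /\ count_upto S i = n].

Definition coded_splice (S : nat -> bool) : set cantor_space :=
  splice S `|` [set (fun i => ~~ S i)].

Definition eventually_false (S : nat -> bool) :=
  S 0 = false /\ exists m, forall i, m <= i -> S i = false.

Lemma compact_coded_splice S : (forall n, compact (D n)) ->
  compact (coded_splice S).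
Proof.
move=> cD; apply: compactU; last exact: compact_set1.
apply: subclosed_compact cantor_space_compact _ => //; apply: closedI.
  move=> x /(scale_closureP cantor_scale)/(_ 1)[y y0 xy].
  by rewrite /= xy.
by apply: closed_bigI => n _; exact: closed_agree_on.
Qed.

Lemma spliceP S x : splice S x <-> exists2 X : nat -> cantor_space,
  (forall n, D n (X n)) & forall i, x i = (0 < i) && X (count_upto S i) i.
Proof.
split=> [[x0 Dx]|[X DX xX]]; last first.
  split=> [|n _]; first by rewrite /= xX.
  by exists (X n) => // i [i0 <-]; rewrite xX i0.
have /choice[X XP] : forall n, exists y, D n y /\
    forall i, 0 < i -> count_upto S i = n -> x i = y i.
  by move=> n; have [//|y Dy xy] := Dx n; exists y; split=> // i i0 in_; apply: xy.
exists X => [n|[|i]]; [exact: (XP n).1|exact: x0|exact: (XP _).2].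
Qed.

Lemma splice_near S S' m x : (forall i, i < m -> S i = S' i) -> splice S x ->
  exists2 x', splice S' x' & cantor_near m x x'.
Proof.
move=> SS' /spliceP[X DX xX].
exists (fun i => (0 < i) && X (count_upto S' i) i); first by apply/spliceP; exists X.
by move=> i im; rewrite xX (eq_count_upto SS').
Qed.

Lemma coded_splice_near S S' m x : (forall i, i < m -> S i = S' i) ->
  coded_splice S x -> exists2 x', coded_splice S' x' & cantor_near m x x'.
Proof.
move=> SS' [/(splice_near SS')[x' ? ?]|->]; first by exists x' => //; left.
by exists (fun i => ~~ S' i); [right|move=> i /SS' ->].
Qed.

Lemma coded_splice0 S x : coded_splice S x -> x 0 -> forall i, S i = ~~ x i.
Proof. by move=> [[/= -> //]|-> _ i]; rewrite negbK. Qed.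

(** Beyond the last element of a finite S, a splice follows one single member of some [D n], and a
    free filter ignores the finite initial piece. *)
Lemma coded_splice_filter (F : pfilter_on nat) S x : free_filter F ->
  (forall n y, D n y -> F (support_set y)) ->
  eventually_false S -> coded_splice S x -> F (support_set x).
Proof.
move=> freeF DF [S0 [m Sm]] [[x0 Dx]|->]; last first.
  apply: (@free_filter_tail F setT _ m) => //; first exact: filterT.
  by move=> i /Sm Si _; rewrite /support_set /= Si.
have [//|y Dy xy] := Dx (count_upto S m).
apply: (@free_filter_tail F (support_set y) _ m.+1) => //; first exact: DF Dy.
move=> i mi; rewrite /support_set /= xy//; split; first exact: leq_ltn_trans mi.
rewrite -(subnKC (ltnW mi)); elim: (i - m) => [|d IH]; first by rewrite addn0.
by rewrite addnS count_uptoS IH Sm ?addn0// leqW// leq_addr.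
Qed.

End splice.

Lemma strong_P_filter_of_hereditarily_baire (F : pfilter_on nat) :
  free_filter F -> hereditarily_baire (vietoris (filter_space F)) ->
  strong_P_filter F.
Proof.
move=> freeF hF C cC.
pose D n : set cantor_space := set_val @` C n.
have cD n : compact (D n).
  apply: continuous_compact (cC n); apply: continuous_subspaceT.
  exact: initial_continuous.
have DF n y : D n y -> F (support_set y).
  by move=> [z _ <-]; exact: set_valP z.
pose isQ S (K : vietoris (filter_space F)) :=
  forall x, set_val K x <-> coded_splice D S (set_val x).
have QF S x : eventually_false S -> coded_splice D S x -> F (support_set x).
  exact: coded_splice_filter.
have exQ S : eventually_false S -> exists K, isQ S K.
  move=> fS; pose K := [set x : filter_space F | coded_splice D S (set_val x)].
  have KP : K \in @nonempty_compacts (filter_space F).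
    apply/mem_set; split.
      apply: compact_filter_space; first exact: compact_coded_splice.
      by move=> x Qx; exact: QF Qx.
    have QS : coded_splice D S (fun i => ~~ S i) by right.
    by exists (SigSub (mem_set (QF _ _ fS QS : [set x | F (support_set x)] _))).
  by exists (SigSub KP).
pose Q := [set K | exists2 S, eventually_false S & isQ S K].
(* [U n] says that the set S coded by a member containing 0 has an element at or above n. It is
   dense in the closure of [Q] because adding a far away point to S hardly changes Q_S. *)
pose U n := [set K : vietoris (filter_space F) | exists2 y, set_val K y &
  set_val y 0 /\ exists2 i, n <= i & ~~ set_val y i].
have sV := vietoris_scale (filter_space_scale F).
have QK S K x : eventually_false S -> isQ S K -> coded_splice D S x ->
    exists2 z, set_val K z & set_val z = x.
  move=> fS KS Qx.
  have Fx : [set x | F (support_set x)] x by exact: QF Qx.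
  by exists (SigSub (mem_set Fx)) => //; apply/KS.
have /baire_space_set_type bQ := hF _ (@closed_closure _ Q).
have [n|n W oW [K [WK QK']]|||K [_ clK UK]] := bQ U _ _ setT.
- apply: (scale_open sV) => K [y Ky [y0 [i ni yi]]]; exists i.+1 => L [KL _].
  have [z Lz yz] := KL _ Ky; exists z => //; split; first by rewrite -yz.
  by exists i => //; rewrite -yz.
- have {K WK QK'}[K [[S [S0 [m Sm]] KS] WK]] : Q `&` W !=set0.
    by apply: QK'; exact: open_nbhs_nbhs.
  have /(scale_nbhsP sV)[r KW] : nbhs K W by exact: open_nbhs_nbhs.
  (* Being beyond r makes the new Q_S' near to K, being beyond n puts it in [U n], and being beyond
     m makes [p.+1] a bound for S'. *)
  pose p := (maxn m (maxn r n)).+1; pose S' i := S i || (i == p).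
  have SS' i : i < r -> S i = S' i.
    rewrite /S' => ir; case: eqP => [ip|]; last by rewrite orbF.
    by move: ir; rewrite ip ltnNge leqW// !leq_max leqnn orbT.
  have fS' : eventually_false S'.
    split; first by rewrite /S' S0.
    exists p.+1 => i pi; rewrite /S' (gtn_eqF pi) Sm//.
    by rewrite (leq_trans _ (ltnW pi))// leqW// leq_maxl.
  have [L LS'] := exQ _ fS'; exists L; split; first split.
  + apply: KW; split=> [x /KS Qx|x /LS' Qx].
      have [y Qy xy] := coded_splice_near SS' Qx.
      by have [z Lz zy] := QK _ _ _ fS' LS' Qy; exists z => //; rewrite zy.
    have [y Qy xy] := coded_splice_near (fun i ir => esym (SS' i ir)) Qx.
    have [|z Kz zy] := QK _ _ y _ KS Qy; first by split=> //; exists m.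
    by exists z => //; rewrite zy => i /xy.
  + by apply: subset_closure; exists S'.
  + have [|z Lz zy] := QK _ _ (fun i => ~~ S' i) fS' LS'; first by right.
    exists z => //; rewrite zy; split; first by rewrite /S' S0.
    by exists p; rewrite /S' ?eqxx ?orbT// leqW// !leq_max leqnn !orbT.
- exact: openT.
- have [|K KS] := exQ (fun=> false); first by split=> //; exists 0.
  exists K; split=> //; apply: subset_closure; exists (fun=> false) => //.
  by split=> //; exists 0.
have {}clK r := (scale_closureP sV Q K).1 clK r.
have [y Ky [y0 _]] := UK 0.
pose S i := ~~ set_val y i.
(* K is a limit of sets Q_S', each of which has only one member containing 0. *)
have yuniq z : set_val K z -> set_val z 0 -> forall i, set_val z i = set_val y i.
  move=> Kz z0 i; have [L [S' fS' LS'] [KL _]] := clK i.+1.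
  have [y' /LS' Qy' yy'] := KL _ Ky; have [z' /LS' Qz' zz'] := KL _ Kz.
  rewrite yy'// zz'//; apply: negb_inj.
  by rewrite -(coded_splice0 Qy') -?(coded_splice0 Qz') -?yy' -?zz'.
have [n|k [k0 kS kc]] := @count_upto_inv S.
  by have [z Kz [z0 [i ni zi]]] := UK n; exists i; rewrite // /S -(yuniq z).
exists k; split=> // X CX.
pose x i := (0 < i) && set_val (X (count_upto S i)) i.
(* Some Q_S' near K has S' equal to S below r; it contains the splice of X along S', which is near
   both x and a member of K. Level [r.+1] also controls the mark at 0 when r = 0. Compactness then
   puts x itself in K. *)
have /choice[u uP] : forall r, exists z, set_val K z /\ cantor_near r x (set_val z).
  move=> r; have [L [S' fS' LS'] [KL LK]] := clK r.+1.
  have [y' /LS' Qy' yy'] := KL _ Ky.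
  have SS' i : i < r -> S i = S' i.
    by move=> ir; rewrite (coded_splice0 Qy') -?yy'// leqW.
  pose x' i := (0 < i) && set_val (X (count_upto S' i)) i.
  have Qx' : coded_splice D S' x'.
    by left; apply/spliceP; exists (set_val \o X) => // n; exists (X n).
  have [z Lz zx'] := QK _ _ _ fS' LS' Qx'; have [w Kw wz] := LK _ Lz.
  exists w; split=> // i ir; rewrite wz ?leqW// zx' /x' /x.
  by rewrite (eq_count_upto SS').
have [cK _] := set_valP K.
have [z Kz zu] := compact_scale_cluster (filter_space_scale F) cK (fun r => (uP r).1).
have zx i : set_val z i = x i.
  have [m im zum] := zu i.+1 i.+1.
  by rewrite zum// (uP m).2.
apply: filterS (set_valP z) => i zi.
exists (count_upto S i) => //; split; last by exact: kc.
by have : set_val z i := zi; rewrite zx => /andP[].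
Qed.

(** * The game form of the strong P-filter property *)

Section game.
Variables (F : pfilter_on nat) (freeF : free_filter F).

(* A node s of the game is a sequence of moves, latest move first.  Splicing the
   compacts below s up to depth n keeps compactness because the pieces with a
   splicing point j >= r coincide with members of D s below r. *)
Fixpoint splices (D : seq nat -> set cantor_space) (n : nat) (s : seq nat) :
    set cantor_space :=
  if n is m.+1 then
    D s `|` \bigcup_j (agree_on (D s) [set i | i < j] `&`
                       agree_on (splices D m (j :: s)) [set i | j <= i])
  else D s.

Lemma compact_splices D n s : (forall t, compact (D t)) -> compact (splices D n s).
Proof.
move=> cD; elim: n s => [|n IH] s //=.
apply: subclosed_compact cantor_space_compact _ => // x clx.
have [Dx|nDx] := pselect (D s x); [by left|right].
have [r rD] : exists r, forall y, D s y -> ~ cantor_near r x y.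
  have clD : closed (D s) by exact: compact_closed cantor_space_hausdorff (cD s).
  apply: contrapT => /forallNP H; apply: nDx; apply: clD.
  apply/(scale_closureP cantor_scale) => r.
  by have /existsNP[y /not_implyP[Dy /contrapT xy]] := H r; exists y.
pose T j := agree_on (D s) [set i | i < j] `&`
            agree_on (splices D n (j :: s)) [set i | j <= i].
(* Near x only the finitely many splicing points j < r occur, so x is in the closure of a finite
   union of closed sets. *)
suff [j jr Tx] : (\bigcup_(j in `I_r) T j) x by exists j.
apply: closed_bigcup => [|j _|]; first exact: finite_II.
  by apply: closedI; apply: closed_agree_on.
apply/(scale_closureP cantor_scale) => q.
have [y + xy] := (scale_closureP cantor_scale _ _).1 clx (maxn q r).
have xyr : cantor_near r x y.
  by apply: (scale_le cantor_scale _ xy); exact: leq_maxr.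
case=> [/rD//|[j _ Tjy]]; exists y; last first.
  by apply: (scale_le cantor_scale _ xy); exact: leq_maxl.
exists j => //=; rewrite ltnNge; apply/negP => rj.
have [[z /rD xz yz] _] := Tjy; apply: xz => i ir.
by rewrite xyr// yz//= (leq_trans ir).
Qed.

Lemma splices_filter D n s x : (forall t y, D t y -> F (support_set y)) ->
  splices D n s x -> F (support_set x).
Proof.
move=> DF; elim: n s x => [|n IH] s x /=; first exact: DF.
case=> [/DF//|[j _ [_ [y /IH Fy xy]]]].
apply: (@free_filter_tail F (support_set y) _ j) => // i /xy.
by rewrite /support_set /= => ->.
Qed.

(** The moves are [k 1], ..., [k n]; [k 0] is not a move, being fixed at 0. *)
Fixpoint position (k : nat -> nat) (n : nat) : seq nat :=
  if n is m.+1 then k n :: position k m else [::].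

Lemma size_position k n : size (position k n) = n.
Proof. by elim: n => //= n ->. Qed.

(** The strong P-filter property is applied to the compact sets of splices of depth n from the root.
    Along the resulting k, splicing X_0, ..., X_n at k_1, ..., k_n gives a member of the n-th
    compact set that coincides with X_n from k_n on. *)
Lemma strong_P_filter_game (C : seq nat -> set (filter_space F)) :
  strong_P_filter F -> (forall s, compact (C s)) ->
  exists k : nat -> nat,
    [/\ k 0 = 0,
        forall n, k n < k n.+1 &
        forall X : nat -> filter_space F, (forall n, C (position k n) (X n)) ->
          F (\bigcup_n (support_set (set_val (X n)) `&`
                        [set i | k n <= i < k n.+1]))].
Proof.
move=> sP cC; pose D s : set cantor_space := set_val @` C s.
have cD s : compact (D s).
  apply: continuous_compact (cC s); apply: continuous_subspaceT.
  exact: initial_continuous.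
have DF s y : D s y -> F (support_set y).
  by move=> [z _ <-]; exact: set_valP z.
have GF n x : splices D n [::] x -> F (support_set x) by exact: splices_filter.
have [n|k [k0 kS kF]] := sP (fun n => [set x | splices D n [::] (set_val x)]).
  apply: compact_filter_space; first exact: compact_splices.
  by move=> x /GF.
have kle m n : m <= n -> k m <= k n.
  by apply: (homo_leq leqnn leq_trans) => i; exact: ltnW.
exists k; split=> // X CX.
(* The witness splices X_m, ..., X_{m+d}; the induction on d starts at a general node because
   [splices] recurses into the children. *)
have exY d m : exists2 y, splices D d (position k m) y &
    forall i, k (m + d) <= i -> y i = set_val (X (m + d)) i.
  elim: d m => [|d IH] m /=.
    by rewrite addn0; exists (set_val (X m)) => //; exists (X m).
  have [y Gy yX] := IH m.+1; rewrite addnS -addSn.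
  exists (fun i => if i < k m.+1 then set_val (X m) i else y i).
    right; exists (k m.+1) => //; split.
      exists (set_val (X m)); first by exists (X m).
      by move=> i /= ->.
    by exists y => // i /=; rewrite leqNgt => /negbTE ->.
  move=> i ki; have mi : k m.+1 <= i by apply: leq_trans ki; exact/kle/leq_addr.
  by rewrite ltnNge mi yX.
have /choice[Y YP] : forall n, exists y : filter_space F,
    splices D n [::] (set_val y) /\
    forall i, k n <= i -> set_val y i = set_val (X n) i.
  move=> n; have [y Gy yX] := exY n 0.
  by exists (SigSub (mem_set (GF _ _ Gy : [set x | F (support_set x)] y))).
have := kF Y (fun n => (YP n).1); apply: filterS => i [n _ [Yi /andP[ki iK]]].
exists n => //; split=> /=; last by rewrite ki.
by rewrite /support_set /= -(YP n).2.
Qed.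

End game.

(** * Limits of Hausdorff-convergent sequences of compact sets of functions *)

Section limit.
Local Open Scope ring_scope.
Variables (R : realType) (F : pfilter_on nat).
Local Notation Z := {ptws NF F -> R}.

Lemma compact_bounded_at (K : set Z) (o : NF F) : compact K ->
  exists B : R, forall f, K f -> `|f o| <= B.
Proof.
move=> cK; have [s _ sK] := compact_scale_net (NF_scale R F) (NF_rank o).+1 cK.
exists (\sum_(g <- s) `|g o| + 1) => f /sK[g gs /interior_subset /(_ o (ltnSn _)) gf].
have g_le : `|g o| <= \sum_(g <- s) `|g o|.
  by rewrite (big_rem g)//= lerDl sumr_ge0.
have := expr_half_le1 R (NF_rank o).+1.
have := ler_distD (g o) (f o) 0; rewrite !subr0 distrC in gf *; lra.
Qed.

Lemma compact_box (B : NF F -> R) :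
  compact [set f : Z | forall o, `|f o| <= B o].
Proof.
suff -> : [set f : Z | forall o, `|f o| <= B o] =
    [set f : Z | forall o, `[- B o, B o]%classic (f o)].
  exact: (@tychonoff (NF F) (fun=> R) (fun o => `[- B o, B o]%classic)
    (fun o => @segment_compact _ _ _)).
by apply/seteqP; split=> f fB o; have := fB o; rewrite /= in_itv /= ler_norml.
Qed.

(** The limit is formed in the full product, where functions need not be continuous. Pointwise
    bounds place it in a compact box, and compactness of the box yields a limit function near each
    member of [L n]. Passing to the limit costs one level. *)
Lemma hscale_limit (L : nat -> set Z) (r : nat -> nat) :
  (forall n, compact (L n)) -> (forall n, (n <= r n)%N) ->
  (forall n j, (n <= j)%N -> hscale (@NF_near R F) (r n).+1 (L n) (L j)) ->
  exists2 K : set Z, compact K & forall n, hscale (@NF_near R F) (r n) (L n) K.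
Proof.
move=> cL nr LL; have sZ := NF_scale R F.
(* Up to j = [NF_rank o] the bound comes from compactness of each [L j]; later sets are near
   [L (NF_rank o)] at a level that controls o, because n <= r n. *)
have /choice[B BP] : forall o : NF F, exists B : R,
    forall j f, L j f -> `|f o| <= B.
  move=> o; have [B BP] : exists B : R, forall j, (j <= NF_rank o)%N ->
      forall f, L j f -> `|f o| <= B.
    elim: (NF_rank o) => [|n [B BP]].
      have [B BP] := compact_bounded_at o (cL 0).
      by exists B => j; rewrite leqn0 => /eqP ->.
    have [B' BP'] := compact_bounded_at o (cL n.+1).
    exists (Num.max B B') => j; rewrite leq_eqVlt => /predU1P[-> f /BP'|jn f /(BP _ jn)];
      by rewrite le_max => ->; rewrite ?orbT.
  exists (B + 1) => j f Lf; have [jo|oj] := leqP j (NF_rank o).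
    by rewrite (le_trans (BP _ jo _ Lf))// lerDl.
  have [_ /(_ _ Lf)[g Lg /(_ o)]] := LL _ _ (ltnW oj).
  rewrite ltnS nr => /(_ isT); have := expr_half_le1 R (r (NF_rank o)).+1.
  have := BP _ (leqnn _) _ Lg.
  have := ler_distD (g o) (f o) 0; rewrite !subr0 distrC; lra.
pose K := [set f : Z | forall n, exists j, (n <= j)%N /\
  exists2 g, L j g & NF_near n f g].
exists K => [|n].
  apply: (subclosed_compact _ (@compact_box (fun o => B o + 1))) => [f|f Kf o].
    move/(scale_closureP sZ) => clf n.
    have [h Kh fh] := clf n.+1; have [j [nj [g Lg hg]]] := Kh n.+1.
    exists j; split; first exact: ltnW.
    by exists g => //; exact: scale_trans sZ _ _ _ _ fh hg.
  have [j [_ [g /BP gB /(_ o (ltnSn _))]]] := Kf (NF_rank o).+1.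
  have := expr_half_le1 R (NF_rank o).+1; have := gB o.
  have := ler_distD (g o) (f o) 0; rewrite !subr0; lra.
split=> [g Lg|f Kf]; last first.
  have [j [nj [h Lh fh]]] := Kf (maxn n (r n).+1).
  have [_ /(_ _ Lh)[g Lg gh]] := LL n j (leq_trans (leq_maxl _ _) nj).
  exists g => //; apply: (scale_trans sZ gh); apply: (scale_sym sZ).
  by apply: (scale_le sZ _ fh); exact: leq_maxr.
have /choice[u uP] : forall j, exists f, L (maxn n j) f /\ NF_near (r n).+1 g f.
  move=> j; have [/(_ _ Lg)[f Lf gf] _] := LL n (maxn n j) (leq_maxl _ _).
  by exists f.
have [j o|f _ fu] := compact_scale_cluster sZ (@compact_box B) (u := u).
  exact: BP (uP j).1.
exists f.
  move=> m; have [j mj fuj] := fu m m; exists (maxn n j); split.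
    by rewrite (leq_trans mj)// leq_maxr.
  by exists (u j) => //; exact: (uP j).1.
have [j _ fuj] := fu (r n).+1 0; apply: (scale_trans sZ (uP j).2).
exact: scale_sym sZ _ _ _ fuj.
Qed.

End limit.

(** * The tree of compact sets, and the implication from (1) to (3) *)

Section strategy.
Local Open Scope ring_scope.
Variables (R : realType) (F : pfilter_on nat) (freeF : free_filter F).
Local Notation Z := {ptws NF F -> R}.
Local Notation V := (vietoris (Cp R (NF F))).
Local Notation near_V :=
  (hscale (fun r (f g : Cp R (NF F)) => NF_near r (set_val f) (set_val g))).

Definition functions_of (K : V) : set Z := set_val @` set_val K.

Lemma compact_functions_of K : compact (functions_of K).
Proof.
have [cK _] := set_valP K.
apply: continuous_compact cK; apply: continuous_subspaceT.
exact: initial_continuous.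
Qed.

Lemma functions_of_continuous K f : functions_of K f -> continuous (f : NF F -> R).
Proof. by move=> [g _ <-]; exact: (set_valP g). Qed.

Lemma hscale_functions_of r K M :
  near_V r (set_val K) (set_val M) <->
  hscale (@NF_near R F) r (functions_of K) (functions_of M).
Proof.
split=> [[KM MK]|[KM MK]]; split.
- by move=> _ [f /KM[g Mg fg] <-]; exists (set_val g) => //; exists g.
- by move=> _ [f /MK[g Kg fg] <-]; exists (set_val g) => //; exists g.
- move=> f Kf; have [|_ [g Mg <-] fg] := KM (set_val f); first by exists f.
  by exists g.
- move=> f Mf; have [|_ [g Kg <-] fg] := MK (set_val f); first by exists f.
  by exists g.
Qed.

(* Only x i = false is constrained, with a non-strict inequality: this makes the
   set closed, and it contains the trace where f oscillates by less than 2^-n. *)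
Definition small_oscillation (n : nat) (K : set Z) : set cantor_space :=
  [set x | exists2 f, K f &
     forall i, x i = false -> 2^-1 ^+ n <= `|f (Some i) - f None|].

Lemma compact_small_oscillation n K : compact K -> compact (small_oscillation n K).
Proof.
move=> cK; apply: subclosed_compact cantor_space_compact _ => // x.
move=> /(scale_closureP cantor_scale) clx.
have /choice[u uP] : forall r, exists f, K f /\ forall i, (i < r)%N ->
    x i = false -> 2^-1 ^+ n <= `|f (Some i) - f None|.
  move=> r; have [y [f Kf yf] xy] := clx r; exists f; split=> // i ir xi.
  by apply: yf; rewrite -xy.
have [f Kf fu] := compact_scale_cluster (NF_scale R F) cK (fun r => (uP r).1).
exists f => // i xi; rewrite leNgt; apply/negP => fi.
have [e0 re] : exists r, 2^-1 ^+ r < 2^-1 ^+ n - `|f (Some i) - f None|.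
  by apply: expr_half_lt; rewrite subr_gt0.
(* Level [e0.+1] keeps the sum of the errors at i and at infinity below 2^-e0, hence below the gap;
   level [i.+2] is the first to control [Some i]. *)
have [m im fum] := fu (maxn e0.+1 i.+2) i.+1.
have := (uP m).2 i im xi.
have h1 : `|f (Some i) - u m (Some i)| < 2^-1 ^+ e0.+1.
  apply: (scale_le (real_scale R) _ (fum (Some i) _)); first exact: leq_maxl.
  by rewrite /= leq_max ltnSn orbT.
have h2 : `|f None - u m None| < 2^-1 ^+ e0.+1.
  apply: (scale_le (real_scale R) _ (fum None _)); first exact: leq_maxl.
  by rewrite /= leq_max orbT.
move: h1 h2 re fi; rewrite exprS.
have := ler_distD (f (Some i)) (u m (Some i)) (u m None).
have := ler_distD (f None) (f (Some i)) (u m None).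
rewrite (distrC (u m (Some i)) (f (Some i))); lra.
Qed.

Lemma small_oscillation_filter n K x : (forall f, K f -> continuous (f : NF F -> R)) ->
  small_oscillation n K x -> F (support_set x).
Proof.
move=> cK [f /cK/NF_continuousP/(_ n) Ff fx]; apply: filterS Ff => i /=.
by rewrite /support_set /= ltNge; apply: contraNT => /negbTE/fx.
Qed.

Lemma hereditarily_baire_of_strong_P_filter :
  strong_P_filter F -> hereditarily_baire V.
Proof.
move=> sP A clA; apply/baire_space_set_type => O oO dO W oW [K0 [WK0 AK0]].
have sV : nbhs_scale (fun r (K M : V) => near_V r (set_val K) (set_val M)).
  exact: vietoris_scale (Cp_scale R F).
pose HN r (K M : V) := near_V r (set_val K) (set_val M).
have sZ := NF_scale R F.
have [r0 r0W] : exists r, HN r K0 `<=` W.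
  by apply/(scale_nbhsP sV); exact: open_nbhs_nbhs.
(* [st] answers the move j at a node K of depth n and level r by some M in A with a whole ball
   inside [O n]. One of the two extra levels pays for a triangle inequality; the other pays for the
   limit, and for the rank shift at coordinates below j. *)
have /choice[st stP] : forall p : nat * (V * nat) * nat, exists Mr : V * nat,
    A p.1.2.1 -> [/\ A Mr.1, HN (maxn p.2 p.1.2.2).+2 p.1.2.1 Mr.1,
      ((maxn p.2 p.1.2.2).+2 <= Mr.2)%N & HN Mr.2 Mr.1 `<=` O p.1.1].
  move=> [[n [K r]] j] /=; have [AK|nAK] := pselect (A K); last by exists (K, r).
  set q := (maxn j r).+2.
  have [||M [[/interior_subset KM AM] OM]] := dO n (HN q K)°.
  - exact: open_interior.
  - exists K; split=> //; apply: nbhs_singleton; apply: nbhs_interior.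
    exact: scale_nbhs sV _ _.
  - have /(scale_nbhsP sV)[r' r'O] : nbhs M (O n) by exact: open_nbhs_nbhs.
    exists (M, maxn q r') => _; split=> //=; first exact: leq_maxl.
    by move=> L ML; apply: r'O; apply: (scale_le sV _ ML); exact: leq_maxr.
pose node := fix node (s : seq nat) : V * nat :=
  if s is j :: s' then st (size s', node s', j) else (K0, r0).
have Anode s : A (node s).1.
  by elim: s => //= j s IH; have [] := stP (size s, node s, j) IH.
pose C s : set (filter_space F) :=
  [set x | small_oscillation (size s) (functions_of (node s).1) (set_val x)].
have cC s : compact (C s).
  apply: compact_filter_space.
    exact/compact_small_oscillation/compact_functions_of.
  by move=> x; apply: small_oscillation_filter => f; exact: functions_of_continuous.
have [k [k0 kS kF]] := strong_P_filter_game freeF sP cC.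
pose L n := (node (position k n)).1; pose r n := (node (position k n)).2.
have step n : [/\ HN (maxn (k n.+1) (r n)).+2 (L n) (L n.+1),
    ((maxn (k n.+1) (r n)).+2 <= r n.+1)%N & HN (r n.+1) (L n.+1) `<=` O n].
  have -> : O n = O (size (position k n)) by rewrite size_position.
  by have [] := stP (size (position k n), node (position k n), k n.+1) (Anode _).
have rS n : ((r n).+2 <= r n.+1)%N.
  by have [_ + _] := step n; apply: leq_trans; rewrite !ltnS leq_maxr.
have nr n : (n <= r n)%N.
  by elim: n => // n IH; apply: leq_trans (rS n); rewrite leqW.
have LL n j : (n <= j)%N -> HN (r n).+1 (L n) (L j).
  move=> /subnKC <-; move: (j - n)%N => d; elim: d n => [|d IH] n.
    by rewrite addn0; exact: scale_refl sV _ _.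
  rewrite addnS -addSn; apply: (scale_trans sV (y := L n.+1)).
    have [+ _ _] := step n; apply: scale_le sV _ _ _ _ _.
    by rewrite !ltnS leq_maxr.
  by apply: (scale_le sV _ (IH n.+1)); rewrite ltnW// ltnS.
have [n|n j nj|K cK LK] := @hscale_limit R F (functions_of \o L) r _ nr.
- exact: compact_functions_of.
- exact/hscale_functions_of/LL.
have KC f : K f -> continuous (f : NF F -> R).
  (* The function g_n in L_n is near f on all of [0, k n.+1) and at infinity. The sets X_n where g_n
     is within 2^-n of its value at infinity are legal plays in [C], so they glue to a member of
     F. *)
  move=> Kf; have /choice[g gP] : forall n, exists g : Cp R (NF F),
      set_val (L n) g /\ NF_near (k n.+1).+1 (set_val g) f.
    move=> n; have [[_ LS] rk _] := step n.
    have [_ /(_ _ Kf)[_ [h Lh <-] hf]] := LK n.+1.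
    have [g Lg gh] := LS _ Lh; exists g; split=> //.
    apply: (scale_trans sZ (y := set_val h)).
      by apply: (scale_le sZ _ gh); rewrite !ltnS leq_maxl.
    by apply: (scale_le sZ _ hf); apply: leq_trans rk; rewrite !ltnS leq_maxl.
  have /choice[X XP] : forall n, exists X : filter_space F, forall i,
      set_val X i = (`|set_val (g n) (Some i) - set_val (g n) None| < 2^-1 ^+ n).
    move=> n; have /NF_continuousP/(_ n) Fg : continuous (set_val (g n) : NF F -> R).
      exact: set_valP (g n).
    by exists (SigSub (mem_set (Fg : [set x | F (support_set x)]
      (fun i => `|set_val (g n) (Some i) - set_val (g n) None| < 2^-1 ^+ n)))).
  apply/NF_continuousP => q.
  (* Beyond [k q.+2] the index n is at least q + 2, and the three errors, each below 2^-(q+2), add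
     up to less than 2^-q. *)
  apply: (@free_filter_tail F _ _ (k q.+2) freeF (kF X _)).
    move=> n; exists (set_val (g n)); first by exists (g n) => //; exact: (gP n).1.
    by move=> i; rewrite XP size_position => /negbT; rewrite -leNgt.
  move=> i ki [n _ [Xi /andP[kn nk]]].
  have kle : {homo k : m p / (m <= p)%N}.
    by apply: (homo_leq leqnn leq_trans) => m; exact: ltnW.
  have qn : (q.+2 <= n)%N.
    by rewrite leqNgt; apply/negP => /kle kn'; move: nk; rewrite ltnNge (leq_trans kn').
  have nkn : (n <= (k n.+1).+1)%N.
    apply/leqW/(leq_trans (leqnSn n)).
    by elim: (n.+1) => // m IH; exact: leq_ltn_trans IH (kS m).
  have gf o : (NF_rank o < (k n.+1).+1)%N -> `|set_val (g n) o - f o| < 2^-1 ^+ q.+2.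
    move=> /(gP n).2; apply: scale_le (real_scale R) _ _ _ _ _.
    exact: leq_trans nkn.
  have g_osc : `|set_val (g n) (Some i) - set_val (g n) None| < 2^-1 ^+ q.+2.
    rewrite -[_ - _]subr0; apply: (scale_le (real_scale R) qn).
    by rewrite subr0 -XP.
  have := gf (Some i) nk; have := gf None (ltn0Sn _); move: g_osc; rewrite !exprS /=.
  have := ler_distD (set_val (g n) (Some i)) (f (Some i)) (f None).
  have := ler_distD (set_val (g n) None) (set_val (g n) (Some i)) (f None).
  rewrite (distrC (f (Some i)) (set_val (g n) (Some i))); have := expr_half_gt0 R q; lra.
pose KX := [set f : Cp R (NF F) | K (set_val f)].
have valKX : set_val @` KX = K.
  apply/seteqP; split=> [_ [f Kf <-]//|f Kf].
  by exists (SigSub (mem_set (KC f Kf : [set f : Z | continuous (f : NF F -> R)] f))).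
have KXP : KX \in @nonempty_compacts (Cp R (NF F)).
  apply/mem_set; split.
    apply: (compact_scale_embedding (Cp_scale R F) sZ (e := set_val)) => [q|].
      by exists q.
    by rewrite valKX.
  have [_ [f Lf]] := set_valP (L 0%N).
  have L0f : functions_of (L 0%N) (set_val f) by exists f.
  have [/(_ _ L0f)[g Kg _] _] := LK 0%N.
  by have : (set_val @` KX) g by [rewrite valKX]; move=> [h Kh _]; exists h.
pose KV : V := SigSub KXP.
have LKV n : HN (r n) (L n) KV.
  by apply/hscale_functions_of; rewrite [functions_of KV]valKX; exact: LK.
exists KV; split.
- exact: r0W (LKV 0%N).
- apply: clA; apply/(scale_closureP sV) => n; exists (L n); first exact: Anode.
  by apply: (scale_le sV (nr n)); exact: scale_sym sV _ _ _ (LKV n).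
- by move=> n; have [_ _] := step n; apply; exact: LKV.
Qed.

End strategy.

Theorem theorem4p3 (R : realType) (F : pfilter_on nat)
    (freeF : free_filter F) :
  [<-> strong_P_filter F;
       hereditarily_baire (vietoris (filter_space F));
       hereditarily_baire (vietoris (Cp R (NF F)))].
Proof.
have P13 := @hereditarily_baire_of_strong_P_filter R F freeF.
have P32 := @hereditarily_baire_vietoris_filter_space R F.
have P21 := strong_P_filter_of_hereditarily_baire freeF.
(* The proved implications form the cycle (1), (3), (2), (1); each implication of the cycle (1),
   (2), (3), (1) is a composite of two of them. *)
by tfae => [/P13/P32|/P21/P13|/P32/P21].
Qed.
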